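(* Let $\rho:\mathbb{N}\to\mathbb{N}$ be a function such that $\frac{\rho(n)}{n}\searrow 0$ (decreases to $0$) as $n\to+\infty$. There exists a Behrend set $\mathscr{B}\subset\mathbb{P}$ of primes such that $X_\eta=X_{\mathscr{B}}$, where $\eta=\mathbf{1}_{\mathcal{F}_{\mathscr{B}}}$, and moreover $$\limsup_{n\to\infty}\frac{\mathrm{cpx}_\eta(n)}{2^{\rho(n)}}\ge 1.$$
   Context: $\mathbb{N}=\{1,2,\ldots\}$ and $\mathbb{P}$ is the set of primes. For $\mathscr{B}\subset\mathbb{N}\setminus\{1\}$, $\mathcal{F}_{\mathscr{B}}$ is the set of $\mathscr{B}$-free integers, i.e. $\mathcal{F}_{\mathscr{B}}=\mathbb{Z}\setminus\bigcup_{b\in\mathscr{B}}b\mathbb{Z}$. $\mathscr{B}$ is Behrend if the natural density $\lim_{N\to\infty}\frac1N|\mathcal{F}_{\mathscr{B}}\cap[1,N]|$ exists and equals $0$. $S$ is the left shift on $\{0,1\}^{\mathbb{Z}}$; $X_\eta:=\overline{\{S^j\eta:j\in\mathbb{Z}\}}$, and $\mathrm{cpx}_\eta(n)$ is the number of distinct blocks of length $n$ appearing in elements of $X_\eta$. A set $A\subset\mathbb{Z}$ is $\mathscr{B}$-admissible if for every $b\in\mathscr{B}$ it misses at least one residue class modulo $b$; $X_{\mathscr{B}}$ is the set of all $x\in\{0,1\}^{\mathbb{Z}}$ whose support $\{i:x(i)=1\}$ is $\mathscr{B}$-admissible. *)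

(* Defs.v *)
From HB Require Import structures.
From mathcomp Require Import all_boot all_order all_algebra finmap.
From mathcomp Require Import all_classical all_reals all_analysis.

Set Implicit Arguments.
Unset Strict Implicit.
Unset Printing Implicit Defensive.
Import Order.TTheory GRing.Theory Num.Theory numFieldNormedType.Exports.

Local Open Scope classical_set_scope.
Local Open Scope ring_scope.

Definition multiples (b : nat) : set int := [set z | (b%:Z %| z)%Z].

Definition Bfree (B : set nat) : set int := ~` \bigcup_(b in B) multiples b.

Definition Bfree_count (B : set nat) (N : nat) : nat :=
  #|` fset_set (Bfree B `&` [set z | 1 <= z <= N%:Z]) |.

(* The limit is insensitive to the junk value at N = 0. *)
Definition Behrend (R : realType) (B : set nat) : Prop :=
  (Bfree_count B N)%:R / N%:R @[N --> \oo] --> (0 : R).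

(* {0,1}^Z with the product of the discrete topologies. *)
Definition fullshift : Type := prod_topology (fun _ : int => bool).

Definition eta_free (B : set nat) : fullshift := fun i => `[< Bfree B i >].

(* [shiftz j] is S^j, for S the left shift. *)
Definition shiftz (j : int) (x : fullshift) : fullshift := fun i => x (i + j).

Definition orbit_closure (x : fullshift) : set fullshift :=
  closure (range (fun j : int => shiftz j x)).

Definition block_at (x : fullshift) (i : int) (n : nat) : n.-tuple bool :=
  [tuple x (i + k%:Z) | k < n].

Definition cpx (x : fullshift) (n : nat) : nat :=
  #|` fset_set [set w : n.-tuple bool |
        exists2 y, orbit_closure x y & exists i : int, block_at y i n = w] |.

Definition admissible (B : set nat) (A : set int) : Prop :=
  forall b : nat, B b ->
    exists r : int, forall a : int, A a -> ~ (a = r %[mod b%:Z])%Z.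

Definition admissible_shift (B : set nat) : set fullshift :=
  [set x | admissible B [set i | x i]].

(* Main.v *)
Require Import Defs.
From HB Require Import structures.
From mathcomp Require Import all_boot all_order all_algebra.
From mathcomp Require Import all_solvable zify finmap.
From mathcomp Require Import all_classical all_reals all_analysis.
Import Order.TTheory GRing.Theory Num.Theory numFieldNormedType.Exports.

(** The set B is built in finite stages; after stage k the chosen primes are
    those dividing an integer Q, and all later primes are taken large.  At each
    stage three things are arranged.
    - One finite 0-1 pattern w is treated, if its support misses a class modulo
      every prime of Q.  The Chinese remainder theorem gives a position where
      the ones of w are coprime to Q, and each zero is made a multiple of a new
      large prime.  As later primes exceed this position, w occurs in eta there.
      Every B-admissible pattern is treated at some stage, so X_B is contained
      in X_eta.
    - Large primes are added so as to halve totient Q / Q; hence B is Behrend.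
      They exist because totient N * (sum of N / d over d | N) <= N ^ 2: take
      for N the product of the numbers 1 + i M! for i < L, L large.
    - Since rho n = o(n), some large n has at least rho n integers coprime to Q
      in [0, n).  Later primes exceed n, so every subset of these integers is
      B-admissible, and there are at least 2 ^ rho n blocks of length n. *)

Local Open Scope nat_scope.

(** * Coprime counts and integers with small totient ratio *)

Lemma coprime_count_period Q k : (0 < Q) ->
  \sum_(0 <= d < k * Q) coprime Q d = k * totient Q.
Proof.
move=> Q0; elim: k => [|k IHk]; first by rewrite !mul0n big_geq.
rewrite (@big_cat_nat _ _ _ (k * Q)) ?leq_mul2r ?leqnSn ?orbT //= IHk.
rewrite [k.+1 * totient Q]mulSnr (totient_count_coprime Q); congr (_ + _).
rewrite -{1}[k * Q]add0n big_addn mulSn addnK.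
apply: eq_bigr => d _; congr nat_of_bool.
by rewrite coprime_sym -coprime_modl addnC modnMDl coprime_modl coprime_sym.
Qed.

(** The interval [[0, a * b)] consists of [a] periods of [b], and coprimality to [a * b] implies
    coprimality to [b]. *)
Lemma totient_mul_leq a b : 0 < b -> totient (a * b) <= a * totient b.
Proof.
move=> b0; rewrite -coprime_count_period // totient_count_coprime.
by apply: leq_sum => d _; rewrite coprimeMl; case: coprime; case: coprime.
Qed.

(* [sum_(d | N) totient (N / d) = N] and [totient N <= d * totient (N / d)]. *)
Lemma totient_sum_quotients N (s : seq nat) : 0 < N -> uniq s ->
  all (dvdn^~ N) s -> totient N * (\sum_(d <- s) N %/ d) <= N * N.
Proof.
move=> N0 us /allP sN.
have quotK d : d \in s -> N %/ d * d = N by move=> /sN; apply: divnK.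
apply: (@leq_trans (N * \sum_(d <- s) totient (N %/ d))).
  rewrite !big_distrr /= !big_seq; apply: leq_sum => d ds.
  rewrite -{1 3}(quotK d ds) mulnC -mulnA leq_mul2l; apply/orP; right.
  rewrite [X in totient X]mulnC totient_mul_leq //.
  by rewrite divn_gt0 ?(dvdn_leq N0) ?sN //; apply: dvdn_gt0 (sN _ ds).
rewrite leq_mul2l; apply/orP; right.
rewrite -[X in _ <= X]sum_totient_dvd -(big_mkord (dvdn^~ N) totient).
rewrite -(big_map (divn N) xpredT totient) -[X in _ <= X]big_filter.
apply: uniq_sub_le_big => //.
- by move=> *; apply: leq_addr.
- rewrite map_inj_in_uniq // => d e ds es de.
  have /eqP := quotK e es; rewrite -{2}(quotK d ds) de eqn_pmul2l.
    by move/eqP.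
  by rewrite divn_gt0 ?(dvdn_leq N0) ?sN //; apply: dvdn_gt0 (sN _ es).
- by rewrite filter_uniq // iota_uniq.
- move=> x /mapP[d ds ->]; rewrite mem_filter dvdn_div ?sN //= mem_index_iota.
  by rewrite ltnS leq_div.
Qed.

(* Dyadic divergence of the harmonic series along the progression
   [1 + D i], cleared of denominators. *)
Lemma progression_harmonic_geq D N m : 0 < D ->
  (forall i, i < 2 ^ m -> D * i + 1 %| N) ->
  m * N <= 2 * D * \sum_(0 <= i < 2 ^ m) N %/ (D * i + 1).
Proof.
move=> D0; elim: m => [|m IHm] HN; first by rewrite mul0n.
have lem : 2 ^ m <= 2 ^ m.+1 by rewrite leq_exp2l.
rewrite (@big_cat_nat _ _ _ (2 ^ m)) //= mulnDr mulSn addnC; apply: leq_add.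
  by apply: IHm => i im; apply: HN; apply: leq_trans lem.
(* Each of the [2 ^ m] new denominators is at most [2 * D * 2 ^ m], so this block alone contributes
   [N]. *)
rewrite -(leq_pmul2l (expn_gt0 2 m)) mulnA.
apply: (@leq_trans (\sum_(2 ^ m <= i < 2 ^ m.+1) N)).
  by rewrite sum_nat_const_nat expnS leq_mul2r; apply/orP; right; lia.
rewrite big_distrr /= big_nat [X in _ <= X]big_nat; apply: leq_sum => i /andP[_ im].
rewrite -{1}(divnK (HN i im)) mulnC leq_mul2r; apply/orP; right.
by move: im; rewrite expnS; nia.
Qed.

(** A prime at most [M] divides [D = M!], hence none of the factors [D * i + 1]. *)
Lemma exists_small_totient M : exists2 Q,
  0 < Q /\ (forall p, prime p -> p %| Q -> M < p) & 2 * totient Q <= Q.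
Proof.
pose D := M`!; have D0 : 0 < D := fact_gt0 M.
(* With [4 * D] dyadic blocks the quotients [Q / (D * i + 1)] sum to at least [2 * Q]. *)
pose L := 2 ^ (4 * D).
pose Q := \prod_(0 <= i < L) (D * i + 1).
have Q0 : 0 < Q by rewrite prodn_gt0 // => i; rewrite addn1.
have QE i : i < L -> D * i + 1 %| Q.
  move=> iL; rewrite /Q (big_rem i) ?mem_index_iota //=; exact: dvdn_mulr.
exists Q; [split=> // p pp|].
  rewrite /Q big_seq; apply: (big_ind (fun q => p %| q -> M < p)).
  - by rewrite dvdn1 => /eqP p1; rewrite p1 in pp.
  - by move=> x y IHx IHy; rewrite Euclid_dvdM // => /orP[].
  - move=> i _ pd; rewrite ltnNge; apply/negP => pM.
    have pD : p %| D by rewrite dvdn_fact // prime_gt0.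
    move: pd; rewrite dvdn_addr ?dvdn_mulr // dvdn1 => /eqP p1.
    by rewrite p1 in pp.
have := progression_harmonic_geq D Q (4 * D) D0 QE; rewrite -/L => harm.
have := totient_sum_quotients Q [seq D * i + 1 | i <- index_iota 0 L] Q0.
have -> : uniq [seq D * i + 1 | i <- index_iota 0 L].
  rewrite map_inj_uniq ?iota_uniq // => i j /eqP; rewrite eqn_add2r.
  by rewrite eqn_pmul2l // => /eqP.
have -> : all (dvdn^~ Q) [seq D * i + 1 | i <- index_iota 0 L].
  by apply/allP => x /mapP[i]; rewrite mem_index_iota => /andP[_ iL] ->; apply: QE.
move=> /(_ isT isT); rewrite big_map => tot; rewrite -(leq_pmul2r Q0); apply: leq_trans tot.
rewrite mulnAC mulnC leq_mul2l; apply/orP; right.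
have D2 : 0 < 2 * D by rewrite muln_gt0.
by rewrite -(leq_pmul2l D2); apply: leq_trans harm; rewrite mulnA; nia.
Qed.

(** * Realizing finite patterns by Chinese remainders *)

(** The default [false] of [nth] turns positions past the end into zeros, so [k] needs no bound. *)
Definition block_avoids_class Q (w : seq bool) :=
  forall p, prime p -> p %| Q ->
  exists r, forall k, nth false w k -> k != r %[mod p].

Lemma avoid_primes (w : seq bool) (s : seq nat) : all prime s -> uniq s ->
  (forall p, p \in s -> exists r, forall k, nth false w k -> k != r %[mod p]) ->
  exists j, forall p k, p \in s -> nth false w k -> ~~ (p %| j + k).
Proof.
elim: s => [|p s IHs] /=; first by exists 0.
move=> /andP[pp ps] /andP[pns us] adm.
have [|j Hj] := IHs ps us; first by move=> q qs; apply: adm; rewrite inE qs orbT.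
have [|r Hr] := adm p; first by rewrite inE eqxx.
have p0 := prime_gt0 pp.
have co : coprime p (\prod_(q <- s) q).
  rewrite big_seq; apply: (big_ind (coprime p)).
  - exact: coprimen1.
  - by move=> x y px py; rewrite coprimeMr px.
  - move=> q qs; rewrite prime_coprime // dvdn_prime2 ?(allP ps q qs) //.
    by apply: contraNneq pns => ->.
(* A position congruent to [- r] modulo [p] makes [p] divide position plus [k] only when [k] is in
   the omitted class [r]. *)
exists (chinese p (\prod_(q <- s) q) (p - r %% p) j) => q k.
rewrite inE => /orP[/eqP->{q}|qs] wk.
  apply: contra (Hr k wk) => /eqP H; apply/eqP.
  apply/eqP; rewrite -(eqn_modDl (p - r %% p)).
  rewrite -modnDml chinese_modl // modnDml in H.
  by rewrite H -[X in _ == X]modnDmr subnK ?modnn // ltnW // ltn_mod.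
have qP : q %| \prod_(q <- s) q by rewrite (big_rem q) //= dvdn_mulr.
rewrite /dvdn -modnDml -(modn_dvdm (chinese _ _ _ _) qP) chinese_modr // modn_dvdm // modnDml.
exact: Hj.
Qed.

Lemma coprime_primes_dvd a b : (forall p, prime p -> p %| a -> p %| b -> False) ->
  0 < b -> coprime a b.
Proof.
move=> H b0; apply: contraT => nco.
have gt1 : 1 < gcdn a b by rewrite ltn_neqAle eq_sym nco gcdn_gt0 b0 orbT.
exfalso; apply: (H (pdiv (gcdn a b))); first exact: pdiv_prime.
- exact: dvdn_trans (pdiv_dvd _) (dvdn_gcdl _ _).
- exact: dvdn_trans (pdiv_dvd _) (dvdn_gcdr _ _).
Qed.

Lemma realize_ones Q (w : seq bool) : 0 < Q -> block_avoids_class Q w ->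
  exists j, forall k, nth false w k -> coprime (j + k) Q.
Proof.
move=> Q0 adm; have [||p|j Hj] := avoid_primes w (primes Q).
- exact: all_prime_primes.
- exact: primes_uniq.
- by rewrite mem_primes => /and3P[pp _ pQ]; apply: adm.
exists j => k wk; apply: coprime_primes_dvd => // p pp pjk pQ.
by move: pjk; apply/negP/Hj; rewrite // mem_primes pp Q0.
Qed.

(** The ones are placed first; then, by induction on [n], each zero receives its own new prime,
    which spoils no one of the pattern. *)
Lemma realize_block Q M (w : seq bool) : 0 < Q -> block_avoids_class Q w ->
  exists T j, [/\ 0 < T, 0 < j, forall p, prime p -> p %| T -> M < p
    & forall k, k < size w -> coprime (j + k) (Q * T) = nth false w k].
Proof.
move=> Q0 adm.
suff H n : n <= size w ->
    exists T j, [/\ 0 < T, forall p, prime p -> p %| T -> M < p,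
    forall k, nth false w k -> coprime (j + k) (Q * T)
    & forall k, k < n -> ~~ nth false w k -> ~~ coprime (j + k) (Q * T)].
  have [T [j [T0 TM ones zeros]]] := H _ (leqnn _).
  have QT0 : 0 < Q * T by rewrite muln_gt0 Q0.
  (* Adding a period makes the position positive. *)
  exists T, (Q * T + j); split=> // [|k kw]; first by rewrite addn_gt0 QT0.
  rewrite -addnA -coprime_modl modnDl coprime_modl.
  by case: (boolP (nth false w k)) => wk; [apply: ones|apply/negbTE/zeros].
elim: n => [_|n IHn nw].
  by have [j Hj] := realize_ones Q w Q0 adm; exists 1, j; split=> // [p pp|k];
    [rewrite dvdn1 => /eqP p1; rewrite p1 in pp | rewrite muln1; apply: Hj].
have [T [j [T0 TM ones zeros]]] := IHn (ltnW nw).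
case: (boolP (nth false w n)) => wn.
  exists T, j; split=> // k; rewrite ltnS leq_eqVlt => /orP[/eqP->|]; last exact: zeros.
  by rewrite wn.
have QT0 : 0 < Q * T by rewrite muln_gt0 Q0.
(* This size makes [q] coprime to [Q * T], larger than [M], and too large to divide two positions of
   the same block. *)
have [q qb qp] := prime_above (Q * T + M + size w).
have q0 := prime_gt0 qp.
have co : coprime (Q * T) q.
  rewrite coprime_sym prime_coprime //; apply/negP => /(dvdn_leq QT0); lia.
(* Modulo [Q * T] nothing changes; modulo [q] the position is [- n], so [q] divides [j' + n]. *)
pose j' := chinese (Q * T) q j (q - n).
have j'l k : coprime (j' + k) (Q * T) = coprime (j + k) (Q * T).
  by rewrite -coprime_modl -modnDml chinese_modl // modnDml coprime_modl.
have j'r k : q %| j' + k = (q %| q - n + k).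
  by rewrite /dvdn -modnDml chinese_modr // modnDml.
exists (T * q), j'; split=> [|p pp|k wk|k].
- by rewrite muln_gt0 T0.
- rewrite Euclid_dvdM // => /orP[|]; first exact: TM.
  by rewrite dvdn_prime2 // => /eqP ->; lia.
- have kw : k < size w by rewrite ltnNge; apply: contraL wk => /(nth_default false) ->.
  rewrite mulnA coprimeMr j'l ones //= coprime_sym prime_coprime // j'r.
  have kn : k <> n by move=> kn; rewrite -kn wk in wn.
  apply/negP => /dvdnP[c]; case: c => [|[|c]]; nia.
- rewrite ltnS leq_eqVlt mulnA coprimeMr => /orP[/eqP -> _|kn wk].
    rewrite negb_and orbC coprime_sym prime_coprime // negbK j'r subnK ?dvdnn //; lia.
  by rewrite j'l (negbTE (zeros k kn wk)).
Qed.

(** * Counts on intervals and the recursion on stages *)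

Lemma coprime_count_geq Q n : 0 < Q -> n %/ Q <= \sum_(0 <= d < n) coprime Q d.
Proof.
move=> Q0; rewrite (@big_cat_nat _ _ _ (n %/ Q * Q)) ?leq_divM //=.
rewrite coprime_count_period //; apply: leq_trans (leq_addr _ _).
by rewrite leq_pmulr // totient_gt0.
Qed.

Lemma coprime_count_leq Q n : 0 < Q ->
  \sum_(0 <= d < n) coprime Q d <= (n %/ Q).+1 * totient Q.
Proof.
move=> Q0; rewrite -coprime_count_period //.
have le : n <= (n %/ Q).+1 * Q by rewrite ltnW // ltn_ceil.
by rewrite [X in _ <= X](@big_cat_nat _ _ _ n) ?leq_addr.
Qed.

Definition realized_at (w : seq bool) Q j :=
  forall i, i < size w -> coprime (j + i) Q = nth false w i.

(* A stage is a pair (Q, M): the primes chosen so far are those dividing Q,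
   and all later ones exceed M. Finite words over bool, enumerated by
   [choice.unpickle], are the patterns to be realised. *)
Definition next_stage (rho : nat -> nat) k (s s' : nat * nat) :=
  [/\ 0 < s'.1, s.1 %| s'.1,
      forall p, prime p -> p %| s'.1 -> ~~ (p %| s.1) -> s.2 < p,
      2 * totient s'.1 * s.1 <= s'.1 * totient s.1 &
  [/\ s.2 <= s'.2,
      forall w : seq bool, choice.unpickle k = Some w -> block_avoids_class s.1 w ->
        exists j, [/\ 0 < j, j + size w <= s'.2 & realized_at w s'.1 j] &
      exists n, [/\ k <= n, n <= s'.2 & rho n <= \sum_(0 <= i < n) coprime s'.1 i]]].

Lemma coprime_mul_large_primes Q T M x : 0 < x -> x <= M -> 0 < T ->
  (forall p, prime p -> p %| T -> M < p) -> coprime x (Q * T) = coprime x Q.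
Proof.
move=> x0 xM T0 TM; rewrite coprimeMr andb_idr // => _.
apply: coprime_primes_dvd => // p pp /(dvdn_leq x0) px /(TM p pp) Mp; lia.
Qed.

Lemma next_stage_exists (rho : nat -> nat) k s :
  (forall Q, exists n0, forall n, n0 <= n -> rho n * Q <= n) ->
  0 < s.1 -> exists s', next_stage rho k s s'.
Proof.
case: s => Q M /= rho_small Q0.
have [T [M1 [T0 TM MM1 QTM1 task]]] : exists T M1, [/\ 0 < T,
    forall p, prime p -> p %| T -> M < p, M <= M1, Q * T <= M1 &
    forall w : seq bool, choice.unpickle k = Some w -> block_avoids_class Q w ->
        exists j, [/\ 0 < j, j + size w <= M1 & realized_at w (Q * T) j]].
  have [[w wk adm]|none] := pselect (exists2 w : seq bool, choice.unpickle k = Some w &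
      block_avoids_class Q w); last first.
    exists 1, (M + Q); split=> // [p pp|||w wk adm].
    - by rewrite dvdn1 => /eqP p1; rewrite p1 in pp.
    - exact: leq_addr.
    - by rewrite muln1 leq_addl.
    - by case: none; exists w.
  have [T [j [T0 j0 TM real]]] := realize_block Q M w Q0 adm.
  exists T, (M + Q * T + (j + size w)); split=> // [||v].
  - by rewrite -addnA leq_addr.
  - by rewrite addnAC leq_addl.
  - by rewrite wk => -[<-] _; exists j; split=> //; rewrite leq_addl.
(* Primes above [M1] are coprime to [Q * T] and exceed every position of the realized block, which
   therefore survives. *)
have [Q' [Q'0 Q'M] small] := exists_small_totient M1.
have QT0 : 0 < Q * T by rewrite muln_gt0 Q0.
have QTQ'0 : 0 < Q * T * Q' by rewrite muln_gt0 QT0.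
have [n0 Hn0] := rho_small (Q * T * Q').
pose n := maxn k n0.
exists (Q * T * Q', M1 + n); split=> //=.
- by rewrite -mulnA dvdn_mulr.
- move=> p pp; rewrite !Euclid_dvdM // => /orP[/orP[->//|]|]; first by move=> /TM ->.
  by move=> /(Q'M _ pp) Mp _; apply: leq_ltn_trans Mp.
- rewrite totient_coprime.
    have := totient_mul_leq T Q Q0; rewrite [T * Q]mulnC => tQT.
    by have := leq_mul (leq_mul small tQT) (leqnn Q); nia.
  apply: coprime_primes_dvd => // p pp /(dvdn_leq QT0) pQT /(Q'M p pp) Mp; lia.
split; first by rewrite (leq_trans MM1) ?leq_addr.
- move=> w wk adm; have [j [j0 jM real]] := task w wk adm.
  exists j; split=> //; first by rewrite (leq_trans jM) ?leq_addr.
  move=> i iw; rewrite (@coprime_mul_large_primes _ _ M1) ?real ?addn_gt0 ?j0 //.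
  by apply: leq_trans jM; rewrite leq_add2l ltnW.
- exists n; rewrite leq_maxl leq_addl; split=> //.
  apply: leq_trans (coprime_count_geq _ _ QTQ'0).
  by rewrite leq_divRL // Hn0 // leq_maxr.
Qed.

Lemma stages_exist (rho : nat -> nat) :
  (forall Q, exists n0, forall n, n0 <= n -> rho n * Q <= n) ->
  exists st : nat -> nat * nat, (st 0).1 = 1 /\
    forall k, next_stage rho k (st k) (st k.+1).
Proof.
move=> rho_small.
(* Positivity of the modulus is a premise inside the choice, so that [f] is total; the recursion
   then preserves it. *)
have /choice[f Hf] : forall ks : nat * (nat * nat), exists s',
    0 < ks.2.1 -> next_stage rho ks.1 ks.2 s'.
  move=> [k s] /=; have [_|s0] := posnP s.1; first by exists s.
  by have [s' Hs'] := next_stage_exists rho k s rho_small s0; exists s'.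
pose st := fix st k := if k is k'.+1 then f (k', st k') else (1, 0).
exists st; split=> //.
have pos k : 0 < (st k).1.
  by elim: k => //= k IHk; case: (Hf (k, st k) IHk).
by move=> k; apply: (Hf (k, st k) (pos k)).
Qed.

Lemma stages_modulus_gt0 rho (st : nat -> nat * nat) k : (st 0).1 = 1 ->
  (forall k, next_stage rho k (st k) (st k.+1)) -> 0 < (st k).1.
Proof. by move=> st0 next; case: k => [|k]; [rewrite st0 | case: (next k)]. Qed.

Lemma stages_totient rho (st : nat -> nat * nat) k : (st 0).1 = 1 ->
  (forall k, next_stage rho k (st k) (st k.+1)) ->
  2 ^ k * totient (st k).1 <= (st k).1.
Proof.
move=> st0 next; elim: k => [|k IHk]; first by rewrite st0.
have Q0 := stages_modulus_gt0 _ _ k st0 next.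
case: (next k) => _ _ _ half _; rewrite -(leq_pmul2r Q0) expnS.
have := leq_mul (leqnn (2 ^ k)) half; have := leq_mul (leqnn (st k.+1).1) IHk.
by nia.
Qed.

(** Earlier moduli divide that of stage [l], and primes added later exceed [x]. *)
Lemma stages_coprime rho (st : nat -> nat * nat) k l x : (st 0).1 = 1 ->
  (forall k, next_stage rho k (st k) (st k.+1)) ->
  0 < x -> x <= (st l).2 -> coprime x (st l).1 -> coprime x (st k).1.
Proof.
move=> st0 next x0 xM cop.
have dv i d : (st i).1 %| (st (d + i)).1.
  elim: d => // d IHd; apply: dvdn_trans IHd _; by case: (next (d + i)).
have mono i d : (st i).2 <= (st (d + i)).2.
  elim: d => // d IHd; apply: leq_trans IHd _; by case: (next (d + i)) => _ _ _ _ [].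
case: (leqP k l) => [kl|/ltnW lk].
  by apply: coprime_dvdr cop; rewrite -(subnK kl).
rewrite -(subnK lk); elim: (k - l) => // d IHd.
apply: coprime_primes_dvd => [p pp px pQ|]; last exact: stages_modulus_gt0 st0 next.
case: (next (d + l)) => _ _ large _ _.
have := large p pp pQ; rewrite -prime_coprime //.
rewrite (coprime_dvdl px IHd) => /(_ isT) lp.
have := dvdn_leq x0 px; have := mono l d; lia.
Qed.

(** * The set of chosen primes and its free integers *)

Definition stage_primes (st : nat -> nat * nat) : set nat :=
  [set p | prime p /\ exists k, p %| (st k).1].

Lemma Bfree_stage_primes (st : nat -> nat * nat) z :
  (forall k, 0 < (st k).1) ->
  Bfree (stage_primes st) z <-> forall k, coprime `|z| (st k).1.
Proof.
move=> pos; split=> [free k|cop [p [pp [k pQ]]]].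
  apply: coprime_primes_dvd => // p pp pz pQ; apply: free.
  by exists p; [split=> //; exists k | rewrite /multiples/= /dvdz].
rewrite /multiples/= /dvdz/= => pz.
move: (coprime_dvdl pz (coprime_dvdr pQ (cop k))).
by rewrite prime_coprime // dvdnn.
Qed.

Lemma eta_stage_primes rho (st : nat -> nat * nat) l x : (st 0).1 = 1 ->
  (forall k, next_stage rho k (st k) (st k.+1)) ->
  0 < x -> x <= (st l).2 ->
  eta_free (stage_primes st) (Posz x) = coprime x (st l).1.
Proof.
move=> st0 next x0 xM; apply/asboolP/idP => [/Bfree_stage_primes|cop].
  by apply=> k; apply: stages_modulus_gt0 st0 next.
apply/Bfree_stage_primes => k; first exact: stages_modulus_gt0 st0 next.
exact: stages_coprime st0 next x0 xM cop.
Qed.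

Local Open Scope classical_set_scope.
Local Open Scope ring_scope.

(** * Zero density *)

(** This moves limits to natural number arithmetic, both for [rho] and for the density of free
    integers. *)
Lemma cvg_ratio0P (R : realType) (u : nat -> nat) :
  (u n)%:R / n%:R @[n --> \oo] --> (0 : R) <->
  forall K : nat, exists n0, forall n, (n0 <= n)%N -> (u n * K <= n)%N.
Proof.
split=> [ucvg K|ule].
  have K0 : 0 < (K.+1%:R : R)^-1 by rewrite invr_gt0.
  have /cvgr0Pnorm_lt/(_ _ K0)[n0 _ Hn0] := ucvg.
  exists n0.+1 => n n0n; have n0' : 0 < n%:R :> R by rewrite ltr0n (leq_trans _ n0n).
  have := Hn0 n (ltnW n0n); rewrite ger0_norm ?divr_ge0 //.
  rewrite ltr_pdivrMr // mulrC ltr_pdivlMr // -natrM ltr_nat => /ltnW.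
  by apply: leq_trans; rewrite leq_mul2l leqnSn orbT.
apply/cvgr0Pnorm_le => e e0.
have [n0 Hn0] := ule (Num.bound e^-1).
near=> n.
have n0' : 0 < n%:R :> R by rewrite ltr0n; near: n; exists 1%N.
rewrite ger0_norm ?divr_ge0 // ler_pdivrMr //.
have e1 : 0 < e^-1 by rewrite invr_gt0.
rewrite -ler_pdivrMl // mulrC.
apply: (@le_trans _ _ ((u n * Num.bound e^-1)%:R)).
  by rewrite natrM ler_wpM2l // ltW // archi_boundP // ltW.
by rewrite ler_nat; apply: Hn0; near: n; exists n0.
Unshelve. all: by end_near. Qed.


Lemma le_card_fset_set (T : choiceType) (s : seq T) (A : set T) :
  finite_set A -> uniq s -> (forall x, x \in s -> A x) ->
  (size s <= #|` fset_set A|)%N.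
Proof.
move=> finA us sA; apply: uniq_leq_size => // x /sA Ax.
by rewrite in_fset_set // inE.
Qed.

Lemma Bfree_count_leq (B : set nat) Q N :
  (forall z, Bfree B z -> coprime `|z| Q) ->
  (Bfree_count B N <= \sum_(0 <= d < N.+1) coprime Q d)%N.
Proof.
move=> BQ; pose s := [seq Posz d | d <- index_iota 0 N.+1 & coprime Q d].
have sub : Bfree B `&` [set z | 1 <= z <= N%:Z] `<=` [set` s].
  move=> z [free /andP[z1 zN]]; have z0 : 0 <= z by apply: le_trans z1.
  apply/mapP; exists `|z|%N; last by rewrite gez0_abs.
  rewrite mem_filter coprime_sym BQ //= mem_index_iota /=; lia.
have fin : finite_set (Bfree B `&` [set z | 1 <= z <= N%:Z]).
  exact: sub_finite_set sub (finite_seq s).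
apply: (@leq_trans (size s)).
  apply: uniq_leq_size => [|z]; first exact: fset_uniq.
  by rewrite in_fset_set // inE => /sub.
rewrite size_map size_filter -sum1_count big_mkcond /=.
by apply: leq_sum => d _; case: coprime.
Qed.

Lemma Behrend_stage_primes (R : realType) rho (st : nat -> nat * nat) :
  (st 0).1 = 1%N -> (forall k, next_stage rho k (st k) (st k.+1)) ->
  Behrend R (stage_primes st).
Proof.
move=> st0 next; apply/cvg_ratio0P => k.
have pos := stages_modulus_gt0 rho st _ st0 next.
have := stages_totient rho st k.+1 st0 next.
set Q := (st k.+1).1 => half; have Q0 : (0 < Q)%N by apply: pos.
(* For [N > Q] the periods covering [[0, N]] have total length at most [N + 1 + Q <= 2 * N]; stage
   [k.+1] supplies a factor 2 to absorb this. *)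
exists Q.+1 => N QN.
have cnt : (Bfree_count (stage_primes st) N <= (N.+1 %/ Q).+1 * totient Q)%N.
  apply: leq_trans (coprime_count_leq _ _ Q0); apply: Bfree_count_leq => z.
  by move=> /(Bfree_stage_primes _ _ pos); apply.
have NQ : (N.+1 %/ Q * Q <= N.+1)%N := leq_divM _ _.
have k2 : (k < 2 ^ k)%N by apply: ltn_expl.
rewrite expnS in half.
have h : ((2 ^ k * 2) * Bfree_count (stage_primes st) N <= 2 * N)%N.
  apply: (@leq_trans ((N.+1 %/ Q).+1 * Q)%N); last by rewrite mulSn; lia.
  apply: leq_trans (leq_mul (leqnn _) half).
  apply: leq_trans (leq_mul (leqnn _) cnt) _.
  by rewrite mulnCA; apply: leq_mul => //; rewrite (mulnC 2%N).
rewrite mulnC; apply: (@leq_trans (2 ^ k * Bfree_count (stage_primes st) N)%N).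
  by rewrite leq_mul2r (ltnW k2) orbT.
by rewrite -(@leq_pmul2l 2) // mulnCA mulnA.
Qed.

(** * Orbit closure and admissibility *)

(** Agreement on a window is a neighbourhood in the product topology; conversely, shifts agreeing on
    growing windows converge pointwise. *)
Lemma orbit_closureP (e x : fullshift) : orbit_closure e x <->
  forall N : nat, exists j : int, forall i : int, (`|i| <= N)%N -> x i = e (i + j).
Proof.
split=> [cl N|H].
  pose D := [fset i | i in [seq (Posz k - Posz N) | k <- iota 0 (2 * N).+1]]%fset.
  have : nbhs (x : {ptws int -> bool}) (\bigcap_(i in [set` D]) [set y | y i = x i]).
    apply: filter_bigI => i _.
    exact: (@proj_continuous _ (fun=> bool) i x [set x i] (discrete_set1 _)).
  move=> /cl[_ [[j _ <-]] Dj]; exists j => i iN.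
  rewrite -(Dj i) //; apply/imfsetP; exists i => //.
  by apply/mapP; exists (absz (i + N%:Z)); [rewrite mem_iota; lia|lia].
have /choice[j Hj] := H.
have cvgj : (fun N => shiftz (j N) e) @ \oo --> (x : {ptws int -> bool}).
  apply/cvg_sup => i; apply/cvg_image; first by rewrite eqEsubset; split=> v // _; exists (cst v).
  move=> U /= Ui.
  exists (@^~ i @^-1` U); last first.
    by rewrite eqEsubset; split=> [b [y Uy <-]//|b Ub]; exists (fun=> b).
  exists `|i|%N => // N iN; rewrite /preimage /= /shiftz -(Hj N i iN).
  exact: nbhs_singleton.
move=> U /cvgj[N _ HN]; exists (shiftz (j N) e); split; first by exists (j N).
exact: (HN N (leqnn N)).
Qed.

Lemma modz_dvd_sub (a r : int) (b : nat) :
  (a = r %[mod b%:Z])%Z <-> (b%:Z %| a - r)%Z.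
Proof. by rewrite -eqz_mod_dvd; split=> /eqP. Qed.

(** If [x] met every class modulo [b], a window with one witness per class would be a copy of
    [eta_free B] at some offset [j]; the witness for the class of [- j] would then sit on a multiple
    of [b]. *)
Lemma orbit_closure_admissible (B : set nat) : (forall b, B b -> (0 < b)%N) ->
  orbit_closure (eta_free B) `<=` admissible_shift B.
Proof.
move=> Bpos x /orbit_closureP cl b Bb; apply: contrapT => noclass.
have /choice[g Hg] : forall r : int, exists a : int, x a /\ (b%:Z %| a - r)%Z.
  move=> r; apply: contrapT => nor; apply: noclass; exists r => a xa ar.
  by apply: nor; exists a; split=> //; apply/modz_dvd_sub.
(* The sum bounds every witness, so one window holds them all. *)
have [j Hj] := cl (\sum_(r < b) `|g (Posz r)|)%N.
have b0 := Bpos _ Bb.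
have rb : (`|((- j) %% b%:Z)%Z| < b)%N by rewrite -ltz_nat gez0_abs ?modz_ge0 ?ltz_pmod //; lia.
have [] := Hg ((- j) %% b%:Z)%Z; rewrite Hj; last first.
  rewrite (bigD1 (Ordinal rb)) //= gez0_abs ?modz_ge0 ?leq_addr //; lia.
move=> /asboolP free dv; apply: free; exists b => //.
rewrite /multiples /=; move/modz_dvd_sub: dv; rewrite modz_mod => /modz_dvd_sub.
by rewrite opprK.
Qed.

Lemma admissible_orbit_closure rho (st : nat -> nat * nat) :
  (st 0).1 = 1%N -> (forall k, next_stage rho k (st k) (st k.+1)) ->
  admissible_shift (stage_primes st) `<=` orbit_closure (eta_free (stage_primes st)).
Proof.
move=> st0 next x adm; apply/orbit_closureP => N.
pose w := [seq x (Posz k - Posz N) | k <- iota 0 (2 * N).+1].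
have sw : size w = (2 * N).+1 by rewrite size_map size_iota.
have nw k : (k < (2 * N).+1)%N -> nth false w k = x (Posz k - Posz N).
  by move=> kN; rewrite (nth_map 0%N) ?size_iota // nth_iota.
(* The code of the central window [w] is the index of the stage that treats it. *)
have [_ _ _ _ [_ task _]] := next (choice.pickle w).
have [|j [j0 jM real]] := task w (choice.pickleK w).
  move=> p pp pQ; have [|r Hr] := adm p; first by split=> //; exists (choice.pickle w).
  have p0 := prime_gt0 pp.
  (* Index [k] of [w] stands for position [k - N] of [x], so the omitted class moves by [N]. *)
  exists `|((r + N%:Z) %% p%:Z)%Z|%N => k wk; apply/eqP => kr.
  have kw : (k < (2 * N).+1)%N.
    by rewrite -sw ltnNge; apply: contraL wk => /(nth_default false) ->.
  rewrite nw // in wk; apply: (Hr _ wk); apply/modz_dvd_sub.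
  rewrite (_ : _ - r = k%:Z - (r + N%:Z)); last lia.
  apply/modz_dvd_sub; rewrite -[RHS]modz_mod -[X in (_ = X %% _)%Z]gez0_abs ?modz_ge0 //.
    by rewrite !modz_nat kr.
  by rewrite eqz_nat -lt0n.
exists (Posz j + N%:Z) => i iN.
have [k ik] : exists k : nat, i = Posz k - N%:Z by exists (absz (i + N%:Z)); lia.
have kN : (k < (2 * N).+1)%N by lia.
rewrite ik -nw // -real ?sw // (_ : _ + _ = Posz (j + k)); last lia.
by rewrite (eta_stage_primes rho st (choice.pickle w).+1) //; lia.
Qed.

(** * Complexity and the upper limit *)

Lemma limn_esup_ge (R : realType) (u : nat -> \bar R) (l : \bar R) :
  (forall k, exists2 n, (k <= n)%N & (l <= u n)%E) -> (l <= limn_esup u)%E.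
Proof.
move=> ul; apply: le_ereal_inf_tmp => _ [A [k _ kA] <-].
have [n kn ln] := ul k; apply: (le_trans ln); apply: ereal_sup_ubound.
by exists n => //; apply: kA.
Qed.

Lemma cpx_geq (x : fullshift) n (A : {set 'I_n}) :
  (forall S : {set 'I_n}, S \subset A -> exists2 y, orbit_closure x y &
     forall i : 'I_n, y (Posz i) = (i \in S)) ->
  (2 ^ #|A| <= cpx x n)%N.
Proof.
move=> H; pose f (S : {set 'I_n}) : n.-tuple bool := [tuple i \in S | i < n].
have finj : injective f.
  move=> S T ST; apply/setP => i; have := congr1 (fun t => tnth t i) ST.
  by rewrite !tnth_mktuple.
rewrite -card_powerset cardE -(size_map f); apply: le_card_fset_set.
- exact: finite_finset.
- by rewrite map_inj_uniq // enum_uniq.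
- move=> w /mapP[S]; rewrite mem_enum powersetE => /H[y cy yS] ->.
  exists y => //; exists 0; apply: eq_from_tnth => i.
  by rewrite !tnth_mktuple add0r yS.
Qed.

Lemma cpx_stage_primes rho (st : nat -> nat * nat) k n :
  (st 0).1 = 1%N -> (forall k, next_stage rho k (st k) (st k.+1)) ->
  admissible_shift (stage_primes st) `<=` orbit_closure (eta_free (stage_primes st)) ->
  (n <= (st k).2)%N ->
  (2 ^ (\sum_(0 <= i < n) coprime (st k).1 i) <= cpx (eta_free (stage_primes st)) n)%N.
Proof.
move=> st0 next sub nM.
pose A := finset (fun i : 'I_n => coprime (st k).1 i).
have -> : (\sum_(0 <= i < n) coprime (st k).1 i = #|A|)%N.
  rewrite big_mkord -sum1_card [RHS]big_mkcond /=.
  by apply: eq_bigr => i _; rewrite inE; case: coprime.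
apply: cpx_geq => S SA.
pose y : fullshift := fun z => [exists i : 'I_n, (i \in S) && (z == Posz i)].
exists y; last first.
  move=> i; apply/existsP/idP => [[i' /andP[i'S /eqP[/ord_inj ->]]] //|iS].
  by exists i; rewrite iS /=.
apply: sub => b [bp [l bQ]].
have b1 := prime_gt1 bp; have b0 := ltnW b1.
have [bk|nbk] := boolP (b %| (st k).1)%N.
  (* A prime of stage [k] misses class 0, as [S] consists of integers coprime to the modulus. *)
  exists 0 => _ /existsP[i /andP[iS /eqP ->]] /modz_dvd_sub; rewrite subr0 => bi.
  have := fintype.subsetP SA i iS; rewrite inE => /(coprime_dvdl bk)/(coprime_dvdr bi).
  by rewrite prime_coprime // dvdnn.
have bM : ((st k).2 < b)%N.
  rewrite ltnNge; apply/negP => bM.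
  have := stages_coprime rho st l k b st0 next b0 bM.
  by rewrite !prime_coprime // nbk bQ => /(_ isT).
(* A later prime exceeds [n], so class [n] misses the support, which lies in [[0, n)]. *)
exists (Posz n) => _ /existsP[i /andP[iS /eqP ->]]; rewrite !modz_nat => -[].
have := ltn_ord i => ilt; rewrite !modn_small //; lia.
Qed.

Theorem theorem1p3 (R : realType) (rho : nat -> nat)
  (rho_gt0 : forall n : nat, (0 < n)%N -> (0 < rho n)%N)
  (rho_decr : forall m n : nat, (0 < m)%N -> (m <= n)%N ->
     (rho n)%:R / n%:R <= (rho m)%:R / m%:R :> R)
  (rho_lim : (rho n)%:R / n%:R @[n --> \oo] --> (0 : R)) :
  exists B : set nat,
    [/\ B `<=` [set p | prime p],
        Behrend R B,
        orbit_closure (eta_free B) = admissible_shift B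
      & (1%:E <= limn_esup (fun n : nat =>
           ((cpx (eta_free B) n)%:R / 2 ^+ rho n : R)%:E))%E].
Proof.
have /cvg_ratio0P rho_small := rho_lim.
have [st [st0 next]] := stages_exist rho rho_small.
have sub := admissible_orbit_closure rho st st0 next.
exists (stage_primes st); split.
- by move=> p [].
- exact: Behrend_stage_primes st0 next.
- apply/seteqP; split=> //; apply: orbit_closure_admissible => b [bp _].
  exact: prime_gt0.
- apply: limn_esup_ge => k.
  (* Stage [k] provides a length [n >= k] at which the ratio is at least 1. *)
  have [_ _ _ _ [_ _ [n [kn nM rhon]]]] := next k.
  exists n => //; rewrite lee_fin ler_pdivlMr ?exprn_gt0 // mul1r -natrX ler_nat.
  apply: leq_trans (cpx_stage_primes rho st k.+1 n st0 next sub nM).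
  by rewrite leq_exp2l.
Qed.
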